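(* Let $b_1>1$ and $c>0$. The surface $SCC$ (the saturated of the coincidence curve by Hugoniot curves) is tangent to the characteristic surface $\mathcal{C}$ and to the sonic$'$ surface $Son'$; that is, $SCC$ meets each of $\mathcal{C}$ and $Son'$, and at every point of $SCC\cap\mathcal{C}$ (respectively $SCC\cap Son'$) the tangent planes of $SCC$ and $\mathcal{C}$ (respectively of $SCC$ and $Son'$) coincide.
   Context: Fix reals $b_1>1$, $a_1,a_2,a_3,a_4$ with $c=a_3-a_2>0$. Consider the flux $F=(f,g)$, $f(u,v)=\frac{v^2}{2}+\frac{(b_1+1)u^2}{2}+a_1u+a_2v$, $g(u,v)=uv+a_3u+a_4v$, and the Rankine-Hugoniot relation $F(u,v)-F(u',v')=s\,(u-u',v-v')$. Put $U=\frac{u+u'}{2}$, $V=\frac{v+v'}{2}$, $X=u-u'$, $Y=v-v'$, $X=zY$, $\widetilde U=b_1U+a_1-a_4$, $V_1=V+a_3$. After blowing up the diagonal, the wave manifold $\mathcal{W}$ is given (away from the plane $\Pi=\{z=\infty\}$) by $(z^2-1)V_1-z\widetilde U+c=0$, $X=zY$, and $\mathcal{W}-\Pi$ is identified with $\mathbb{R}^3$ with coordinates $(z,t,Y)$ through $$\widetilde U=\frac{2cz}{z^2+1}+ct(z^2-1),\qquad V_1=\frac{c}{z^2+1}+ctz .$$ A Hugoniot curve is a set $\{u=u_0,\ v=v_0\}$ in $\mathcal{W}-\Pi$; equivalently, a set of points $(z,t,Y)\in\mathbb{R}^3$ on which both $\widetilde U+\frac{b_1}{2}zY$ and $V_1+\frac12Y$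 take given constant values. The characteristic surface is $\mathcal{C}=\{Y=0\}$. The coincidence curve in $\mathcal{C}$ is $\mathcal{E}_{\mathcal{C}}=\{(z,t,Y): t=0,\ Y=0\}$. The surface $SCC$ is the two-dimensional submanifold formed by the union of all Hugoniot curves through points of $\mathcal{E}_{\mathcal{C}}$. The sonic$'$ surface $Son'$ (critical points of the speed $s$ along Hugoniot$'$ curves $\{u'=\text{const},\ v'=\text{const}\}$) is the set of $(z,t,Y)$ with $$-2c\left[(b_1+1)z^5+(b_1+4)z^3+3z\right]t+\left[(b_1+1)z^4+b_1z^2-1\right]Y-2c\left[(b_1-1)z^2+1\right]=0 .$$ *)

(* Defs.v *)
(* MathComp-Analysis *)
From mathcomp Require Import all_boot all_order all_algebra.
From mathcomp Require Import all_classical all_reals all_analysis.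
From mathcomp Require Import ring lra.

Set Implicit Arguments.
Unset Strict Implicit.
Unset Printing Implicit Defensive.

Import Order.TTheory GRing.Theory Num.Theory.
Import numFieldNormedType.Exports.

Local Open Scope classical_set_scope.
Local Open Scope ring_scope.


Section Tangency.
Context {R : realType}.
Implicit Types (S : set (R * R * R)) (p q : R * R * R).

(* S is an embedded C^1 surface in a neighbourhood of p: there it is the zero
   set of a C^1 function whose differential at p does not vanish. *)
Definition is_surface_at S p : Prop :=
  exists h : R * R * R -> R,
    [/\ \forall q \near p, differentiable h q /\
          forall v, {for q, continuous (fun x => 'd h x v)},
        exists v, 'd h p v != 0
      & \forall q \near p, S q <-> h q = 0].

(* Velocities at p of the curves drawn on S; when S is a surface at p this is
   its tangent plane (as a linear subspace of R^3). *)
Definition tangent_space S p : set (R * R * R) :=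
  [set w | exists gamma : R -> R * R * R,
    [/\ gamma 0 = p, \forall r \near (0 : R), S (gamma r)
      & is_derive (0 : R) (1 : R) gamma w]].

Definition tangent_at S1 S2 p : Prop :=
  [/\ is_surface_at S1 p, is_surface_at S2 p
    & tangent_space S1 p = tangent_space S2 p].

Definition tangent_surfaces S1 S2 : Prop :=
  S1 `&` S2 !=set0 /\ forall p, (S1 `&` S2) p -> tangent_at S1 S2 p.

End Tangency.

(* W - Pi is R^3, a point p being the triple (z, t, Y). *)
Section WaveManifold.
Context {R : realType}.
Variables b1 a1 a2 a3 a4 : R.
Implicit Type p : R * R * R.

Definition flux_f (u v : R) : R :=
  v ^+ 2 / 2 + (b1 + 1) * u ^+ 2 / 2 + a1 * u + a2 * v.

Definition flux_g (u v : R) : R := u * v + a3 * u + a4 * v.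

Definition cc : R := a3 - a2.

Definition z_of p : R := p.1.1.
Definition t_of p : R := p.1.2.
Definition Y_of p : R := p.2.
Definition X_of p : R := z_of p * Y_of p.

Definition tildeU p : R :=
  2 * cc * z_of p / (z_of p ^+ 2 + 1) + cc * t_of p * (z_of p ^+ 2 - 1).

Definition V1 p : R := cc / (z_of p ^+ 2 + 1) + cc * t_of p * z_of p.

(* The midpoints, solved from tildeU = b1 U + a1 - a4 and V1 = V + a3. *)
Definition U_of p : R := (tildeU p - a1 + a4) / b1.
Definition V_of p : R := V1 p - a3.

(* The end states of the shock represented by p: (u, v) and (u', v'). *)
Definition uR p : R := U_of p + X_of p / 2.
Definition vR p : R := V_of p + Y_of p / 2.
Definition uL p : R := U_of p - X_of p / 2.
Definition vL p : R := V_of p - Y_of p / 2.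

Definition speed p : R := U_of p + z_of p * V1 p + a4.

Lemma wave_manifold_eq p :
  (z_of p ^+ 2 - 1) * V1 p - z_of p * tildeU p + cc = 0.
Proof.
have z0 : z_of p ^+ 2 + 1 != 0 by rewrite gt_eqF// ltr_wpDl// sqr_ge0.
by rewrite /V1 /tildeU; field; exact: z0.
Qed.

Lemma rankine_hugoniot p : b1 != 0 ->
  flux_f (uR p) (vR p) - flux_f (uL p) (vL p) = speed p * (uR p - uL p) /\
  flux_g (uR p) (vR p) - flux_g (uL p) (vL p) = speed p * (vR p - vL p).
Proof.
case: p => [[z t] Y] b10.
have z0 : z ^+ 2 + 1 != 0 by rewrite gt_eqF// ltr_wpDl// sqr_ge0.
rewrite /speed /flux_f /flux_g /uR /uL /vR /vL /U_of /V_of /X_of /V1 /tildeU.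
rewrite /cc /z_of /t_of /Y_of /=.
by split; field; rewrite b10 z0.
Qed.

Definition hugoniot_curve (u0 v0 : R) : set (R * R * R) :=
  [set p | uR p = u0 /\ vR p = v0].

Definition characteristic_surface : set (R * R * R) := [set p | Y_of p = 0].

Definition coincidence_curve : set (R * R * R) :=
  [set p | t_of p = 0 /\ Y_of p = 0].

Definition SCC : set (R * R * R) :=
  \bigcup_(e in coincidence_curve) hugoniot_curve (uR e) (vR e).

(* Locus of the critical points of the speed along the curves
   u' = const, v' = const, in the coordinates (z, t, Y). *)
Definition sonic' : set (R * R * R) :=
  [set p | - 2 * cc * ((b1 + 1) * z_of p ^+ 5 + (b1 + 4) * z_of p ^+ 3
                       + 3 * z_of p) * t_of p
           + ((b1 + 1) * z_of p ^+ 4 + b1 * z_of p ^+ 2 - 1) * Y_of p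
           - 2 * cc * ((b1 - 1) * z_of p ^+ 2 + 1) = 0].

End WaveManifold.

Arguments characteristic_surface : clear implicits.
Arguments coincidence_curve : clear implicits.

(* Main.v *)
Require Import Defs.
From mathcomp Require Import all_boot all_order all_algebra.
From mathcomp Require Import all_classical all_reals all_analysis.
From mathcomp Require Import ring lra.
Import Order.TTheory GRing.Theory Num.Theory.
Import numFieldNormedType.Exports.
Local Open Scope classical_set_scope.
Local Open Scope ring_scope.

(** In the coordinates A = tildeU + b1/2 zY and B = V1 + Y/2, which are constant
    along Hugoniot curves, the coincidence curve (s, 0, 0) becomes
    A = 2cs/(s^2+1), B = c/(s^2+1): the conic A^2 + 4B^2 = 4cB without the
    origin. Hence SCC is the set where Q = A^2 + 4B^2 - 4cB vanishes and B does
    not ([SCC_equation]).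

    Put D = (b1-1)z^2 + 1 and E = (b1+1)z^2 + 1, both positive, and let G be the
    polynomial defining Son'. Tangency is carried by two identities
    ([SCC_char_relation], [SCC_sonic'_relation]), valid on all of R^3:
        2BD Y + (2zB - A)^2                = Q,
        BD G  + 2(z^2+1)(zA - EB)^2        = 2(z^2+1)z^2 Q.
    At a common zero of Q and Y, respectively of Q and G, the square also
    vanishes, and to second order; so differentiating leaves 2BD dY = dQ,
    respectively BD dG = 2(z^2+1)z^2 dQ ([diff_relation]). On SCC the factor BD
    is nonzero, and z <> 0 at the sonic' points of SCC because z = 0 would turn
    the second identity into 2B^2 = 0; the t-derivative
    -2cz(z^2+1)(E+2) of G is then nonzero too. The differentials are therefore
    proportional and nonzero. Finally the velocities of curves on a surface
    h = 0 with dh <> 0 fill exactly ker dh ([tangent_space_kernel]), and so the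
    tangent planes agree.

    To guess the second identity: the points of SCC on the Hugoniot curve of
    (s, 0, 0) satisfy Y = -2c(z-s)^2 / ((s^2+1)D), and there G is a negative
    multiple of (2zs - E)^2, where s = A/(2B). *)

(** * Curves with a prescribed velocity on a level set *)

Section TangentSpaces.
Context {R : realType} {V : normedModType R}.
Implicit Types (h : V -> R) (p v w : V).

Lemma diff_approx h p (e : R) : differentiable h p -> 0 < e ->
  \forall u \near (0 : V), `|h (p + u) - h p - 'd h p u| <= e * `|u|.
Proof.
move=> /diff_locally dh e0.
have /eqaddoP/(_ e e0) := dh.
apply: filterS => u; rewrite -addrA -opprD [p + u]addrC; exact.
Qed.

Lemma diff_velocity_eq0 h p (gamma : R -> V) w :
  differentiable h p -> gamma 0 = p ->
  (\forall r \near (0 : R), h (gamma r) = 0) ->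
  is_derive (0 : R) (1 : R) gamma w -> 'd h p w = 0.
Proof.
move=> dh g0 hg [dg gw].
have dg' : differentiable gamma 0 by apply/derivable1_diffP.
have dhg : differentiable h (gamma 0) by rewrite g0.
rewrite -g0 -gw deriveE// -[LHS]/(('d h (gamma 0) \o 'd gamma 0) 1).
rewrite -diff_comp// -deriveE; last exact: differentiable_comp.
by rewrite (near_eq_derive (g := cst 0))// derive_cst.
Qed.

(** Moving along a kernel direction w changes h only by o(r), whereas moving by
    y along v changes it by about y times a positive constant; a correction y
    of size e|r| is thus enough to force a change of sign. *)
Lemma root_near_kernel h p v w (e : R) :
  (\forall q \near p, differentiable h q) ->
  h p = 0 -> 0 < 'd h p v -> 'd h p w = 0 -> 0 < e ->
  \forall r \near (0 : R),
    exists2 y, `|y| <= e * `|r| & h (p + (r *: w + y *: v)) = 0.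
Proof.
move=> dh hp0 hv hw e0.
set k := 'd h p v in hv *.
(* M |r| bounds the displacement r w + y v when |y| <= e |r|. *)
pose M := `|w| + e * `|v| + 1.
have M0 : 0 < M by rewrite ltr_wpDl// addr_ge0// mulr_ge0// ltW.
have dhp : differentiable h p by exact: nbhs_singleton dh.
have eta0 : 0 < e * k / M by rewrite divr_gt0// mulr_gt0.
have [rho /= rho0 Hrho] : exists2 rho, 0 < rho & forall u : V, `|u| < rho ->
    differentiable h (p + u) /\
    `|h (p + u) - h p - 'd h p u| <= e * k / M * `|u|.
  have /nbhs0P H1 := dh.
  have H2 := diff_approx _ _ _ dhp eta0.
  have [rho rho0 H] := iffLR nbhs_norm0P (filterI H1 H2).
  by exists rho => // u ur; apply: H.
have small (r y : R) : `|r| < rho / M -> `|y| <= e * `|r| ->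
    `|r *: w + y *: v| <= M * `|r| /\ `|r *: w + y *: v| < rho.
  move=> rM yr.
  have uM : `|r *: w + y *: v| <= M * `|r|.
    rewrite (le_trans (ler_normD _ _))// !normrZ /M.
    have := ler_wpM2r (normr_ge0 v) yr.
    have := normr_ge0 r; nra.
  by split=> //; apply: (le_lt_trans uM); rewrite mulrC -ltr_pdivlMr.
apply: (iffRL nbhs_norm0P); exists (rho / M); first by rewrite /= divr_gt0.
move=> r /= rM.
have er0 : 0 <= e * `|r| by rewrite mulr_ge0// ltW.
pose F (y : R) := h (p + (r *: w + y *: v)).
have Fk (y : R) : `|y| <= e * `|r| -> `|F y - y * k| <= e * k * `|r|.
  move=> yr; have [uM urho] := small r y rM yr.
  have [_ +] := Hrho _ urho; rewrite hp0 subr0.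
  have -> : 'd h p (r *: w + y *: v) = y * k.
    by rewrite linearD !linearZ /= hw scaler0 add0r.
  move=> /le_trans; apply.
  rewrite (le_trans (ler_wpM2l (ltW eta0) uM))//.
  by rewrite mulrA divfK// gt_eqF.
have yabs (y : R) : y \in `[- (e * `|r|), e * `|r|] -> `|y| <= e * `|r|.
  by rewrite in_itv /= ler_norml.
have [||y yI Fy] := @IVT R F (- (e * `|r|)) (e * `|r|) 0 (ge0_cp er0).2.
- apply: continuous_in_subspaceT => y /set_mem /yabs yr.
  have [_ urho] := small r y rM yr.
  have [/differentiable_continuous ch _] := Hrho _ urho.
  rewrite /F; apply: (@continuous_comp _ _ _
    (fun y : R => p + (r *: w + y *: v)) h) => //.
  apply: cvgD; first exact: cvg_cst.
  by apply: cvgD; [exact: cvg_cst|apply: cvgZr_tmp].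
- have := Fk (e * `|r|); have := Fk (- (e * `|r|)).
  rewrite normrN ger0_norm// lexx => /(_ isT) + /(_ isT).
  rewrite !ler_norml => /andP[_ H1] /andP[H2 _].
  by rewrite ge_min le_max; apply/andP; split; apply/orP; [left|right]; lra.
- by exists y => //; apply: yabs.
Qed.

(** The curve is p + r w + y(r) v, and it has velocity w as soon as y(r) = o(r).
    [root_near_kernel] gives a root for each e separately; choosing y(r) among
    the roots within r^2 of the smallest possible size makes one function that
    serves all e at once. *)
Lemma curve_with_velocity h p v w :
  (\forall q \near p, differentiable h q) ->
  h p = 0 -> 0 < 'd h p v -> 'd h p w = 0 ->
  exists gamma : R -> V, [/\ gamma 0 = p,
    \forall r \near (0 : R), h (gamma r) = 0
    & is_derive (0 : R) (1 : R) gamma w].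
Proof.
move=> dh hp0 hv hw.
pose roots r := [set y | h (p + (r *: w + y *: v)) = 0].
pose sizes r := [set `|y| | y in roots r].
have lb r : has_lbound (sizes r) by exists 0 => _ [y _ <-].
have /choice[y Hy] : forall r, exists y, (r = 0 -> y = 0) /\
    (roots r !=set0 -> roots r y /\ `|y| <= inf (sizes r) + r ^+ 2).
  move=> r; have [->|r0] := eqVneq r 0.
    exists 0; split=> // _; split; first by rewrite /roots/= !scale0r !addr0.
    rewrite normr0 expr0n/= addr0; apply: lb_le_inf.
      by exists 0, 0 => //; rewrite ?normr0// /roots/= !scale0r !addr0.
    by move=> _ [y _ <-].
  have [[y0 ry0]|no] := pselect (roots r !=set0); last first.
    by exists 0; split.
  have r2 : 0 < r ^+ 2 by rewrite exprn_even_gt0.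
  have [|_ [y ry <-] yr] := @inf_adherent _ (sizes r) _ r2.
    by split=> //; exists `|y0|, y0.
  by exists y; split=> [/eqP|_]; [rewrite (negbTE r0)|split=> //; exact: ltW].
have y0 : y 0 = 0 by apply: (Hy 0).1.
have ysmall (e : R) : 0 < e ->
    \forall r \near (0 : R), roots r (y r) /\ `|y r| <= e * `|r|.
  move=> e0.
  have e20 : 0 < e / 2 by rewrite divr_gt0.
  near=> r.
  have [x xr rx] : exists2 x, `|x| <= e / 2 * `|r| & roots r x.
    by near: r; apply: root_near_kernel.
  have [|ry yr] := (Hy r).2; first by exists x.
  split=> //; apply: (le_trans yr).
  have infx : inf (sizes r) <= `|x| by apply: (ge_inf (lb r)); exists x.
  have re : `|r| <= e / 2 by near: r; exact: (@nbhs0_le R R).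
  have : r ^+ 2 <= e / 2 * `|r|.
    by rewrite -(ger0_norm (sqr_ge0 r)) normrX expr2 ler_wpM2r.
  lra.
exists (fun r => p + (r *: w + y r *: v)); split.
- by rewrite y0 !scale0r !addr0.
- by apply: filterS (ysmall 1 ltr01) => r [].
pose gamma r := p + (r *: w + y r *: v).
have quotE : (fun r : R => r^-1 *: ((gamma \o shift (0 : R)) (r *: (1 : R))
    - gamma 0)) = fun r => r^-1 *: (r *: w + y r *: v).
  apply/funext => r; rewrite /gamma /= y0 !scale0r !addr0 [r *: 1]mulr1.
  by rewrite addrAC subrr add0r.
suff cw : (fun r => r^-1 *: (r *: w + y r *: v)) @ 0^' --> w.
  rewrite -/gamma; apply: DeriveDef; rewrite /derivable /derive quotE.
    by apply: cvgP cw.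
  exact: cvg_lim.
apply/cvgrPdist_le => e e0 /=.
have v1 : 0 < `|v| + 1 by rewrite ltr_wpDl.
have e1 : 0 < e / (`|v| + 1) by rewrite divr_gt0.
near=> r.
have r0 : 0 < `|r| by rewrite normr_gt0; near: r; exact: nbhs_dnbhs_neq.
have [_ yr] : roots r (y r) /\ `|y r| <= e / (`|v| + 1) * `|r|.
  by near: r; apply: cvg_within; exact: ysmall.
rewrite scalerDr scalerA mulVf -?normr_gt0// scale1r opprD addrA subrr sub0r.
rewrite normrN normrZ normfV normrZ ler_pdivrMl//.
have vle : `|v| <= `|v| + 1 by rewrite lerDl.
apply: le_trans (ler_wpM2r (normr_ge0 v) yr) _.
rewrite [leRHS]mulrC mulrAC ler_wpM2r// mulrAC ler_pdivrMr//.
by rewrite ler_wpM2l// ltW.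
Unshelve. all: by end_near. Qed.
End TangentSpaces.

(** * Continuously differentiable functions *)

(** A record rather than a conjunction, so that unification does not unfold it
    when two of its instances fail to match. *)
Record C1 {R : realType} {V : normedModType R} (f : V -> R) : Prop := {
  C1_differentiable : forall q, differentiable f q;
  C1_diff_continuous : forall v, continuous (fun x => 'd f x v) }.

Arguments C1_differentiable {R V f} _ _.
Arguments C1_diff_continuous {R V f} _ _ _.

Section ContinuouslyDifferentiable.
Context {R : realType} {V : normedModType R}.
Implicit Types f g k e m h : V -> R.

Lemma C1_continuous f : C1 f -> continuous f.
Proof.
by move=> cf q; apply: differentiable_continuous (C1_differentiable cf q).
Qed.

Lemma diffD_apply f g p v : C1 f -> C1 g ->
  'd (fun x => f x + g x) p v = 'd f p v + 'd g p v.
Proof.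
move=> cf cg; have /(congr1 (@^~ v)) :=
  diffD (C1_differentiable cf p) (C1_differentiable cg p).
exact.
Qed.

Lemma diffM_apply f g p v : C1 f -> C1 g ->
  'd (fun x => f x * g x) p v = f p * 'd g p v + g p * 'd f p v.
Proof.
move=> cf cg; have /(congr1 (@^~ v)) :=
  diffM (C1_differentiable cf p) (C1_differentiable cg p).
exact.
Qed.

Lemma C1_cst (a : R) : C1 (fun _ : V => a).
Proof.
split=> [q|v q]; first exact: differentiable_cst.
have -> : (fun x => 'd (fun=> a) x v) = cst (0 : R).
  by apply/funext => x; rewrite -[LHS]/('d (cst a) x v) diff_cst.
exact: cvg_cst.
Qed.

Lemma C1_linear (f : {linear V -> R}) : continuous f -> C1 f.
Proof.
move=> cf; split=> [q|v q]; first exact: linear_differentiable.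
have -> : (fun x => 'd f x v) = cst (f v).
  by apply/funext => x; rewrite diff_lin.
exact: cvg_cst.
Qed.

Lemma C1D f g : C1 f -> C1 g -> C1 (fun x => f x + g x).
Proof.
move=> cf cg; split=> [q|v q].
  exact: differentiableD (C1_differentiable cf q) (C1_differentiable cg q).
have -> : (fun x => 'd (fun x => f x + g x) x v)
    = fun x => 'd f x v + 'd g x v.
  by apply/funext => x; exact: diffD_apply.
by apply: cvgD; [exact: C1_diff_continuous cf v q|
                 exact: C1_diff_continuous cg v q].
Qed.

Lemma C1M f g : C1 f -> C1 g -> C1 (fun x => f x * g x).
Proof.
move=> cf cg; split=> [q|v q].
  exact: differentiableM (C1_differentiable cf q) (C1_differentiable cg q).
have -> : (fun x => 'd (fun x => f x * g x) x v)
    = fun x => f x * 'd g x v + g x * 'd f x v.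
  by apply/funext => x; exact: diffM_apply.
apply: cvgD; apply: cvgM.
- exact: C1_continuous.
- exact: C1_diff_continuous cg v q.
- exact: C1_continuous.
- exact: C1_diff_continuous cf v q.
Qed.

Lemma C1V f : C1 f -> (forall x, f x != 0) -> C1 (fun x => (f x)^-1).
Proof.
move=> cf f0; split=> [q|v q].
  exact: differentiableV (C1_differentiable cf q) (f0 q).
have -> : (fun x => 'd (fun x => (f x)^-1) x v)
    = fun x => - (f x)^-1 * (f x)^-1 * 'd f x v.
  apply/funext => x.
  have /(congr1 (@^~ v)) := diffV (C1_differentiable cf x) (f0 x).
  by rewrite /= => ->; rewrite -exprVn expr2 -mulNr.
apply: cvgM; last exact: (C1_diff_continuous cf v).
have fV : (fun x => (f x)^-1) @ q --> (f q)^-1.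
  by apply: cvgV => //; exact: C1_continuous.
by apply: cvgM => //; exact: cvgN.
Qed.

Lemma C1N f : C1 f -> C1 (fun x => - f x).
Proof.
move=> cf; have -> : (fun x => - f x) = fun x => - 1 * f x.
  by apply/funext => x; rewrite mulN1r.
exact: (C1M _ _ (C1_cst (- 1)) cf).
Qed.

Lemma C1X f n : C1 f -> C1 (fun x => f x ^+ n).
Proof.
move=> cf; elim: n => [|n IHn]; first exact: C1_cst.
have -> : (fun x => f x ^+ n.+1) = fun x => f x * f x ^+ n.
  by apply/funext => x; rewrite exprS.
exact: C1M.
Qed.

Lemma diff_along_line f p v (a : R) : differentiable f p ->
  (forall r : R, f (p + r *: v) = f p + r * a) -> 'd f p v = a.
Proof.
move=> df fl; rewrite -deriveE//; apply: cvg_lim => //.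
apply: (cvg_near_cst a); near=> r.
have r0 : r != 0 by near: r; exact: nbhs_dnbhs_neq.
rewrite /= [r *: v + p]addrC fl addrAC subrr add0r.
exact: mulKf.
Unshelve. all: by end_near. Qed.

(** A square contributes nothing to the differential at its zeros, and at a
    common zero of g and h the identity forces the square to vanish. *)
Lemma diff_relation f g k e m h p w :
  C1 f -> C1 g -> C1 k -> C1 e -> C1 m -> C1 h ->
  (forall q, f q * g q + k q * e q ^+ 2 = m q * h q) ->
  k p != 0 -> g p = 0 -> h p = 0 -> f p * 'd g p w = m p * 'd h p w.
Proof.
move=> cf cg ck ce cm ch rel kp gp hp.
have ep : e p = 0.
  have /eqP := rel p; rewrite gp hp !mulr0 add0r mulf_eq0 (negbTE kp) /=.
  by rewrite expf_eq0 => /andP[_ /eqP].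
have dM (a b : V -> R) : C1 a -> C1 b -> b p = 0 ->
    'd (fun q => a q * b q) p w = a p * 'd b p w.
  move=> ca cb bp; apply: (etrans (diffM_apply _ _ p w ca cb)).
  by rewrite bp mul0r addr0.
have cee : C1 (fun q => e q ^+ 2) by exact: C1X.
have de2 : 'd (fun q => e q ^+ 2) p w = 0.
  by apply: (etrans (dM e e ce ce ep)); rewrite ep mul0r.
have dke : 'd (fun q => k q * e q ^+ 2) p w = 0.
  have e2p : e p ^+ 2 = 0 by rewrite ep expr0n.
  by apply: (etrans (dM k _ ck cee e2p)); rewrite de2 mulr0.
have dsum := diffD_apply _ _ p w (C1M _ _ cf cg) (C1M _ _ ck cee).
have dE := congr1 (fun F : V -> R => 'd F p w) (funext rel).
apply: (etrans (esym (dM f g cf cg gp))).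
apply: (etrans (esym (etrans (congr1 (GRing.add _) dke) (addr0 _)))).
exact: etrans (esym dsum) (etrans dE (dM m h cm ch hp)).
Qed.
End ContinuouslyDifferentiable.

(** * Tangent planes of level sets *)

Section Criterion.
Context {R : realType}.
Implicit Types (S : set (R * R * R)) (h : R * R * R -> R) (p : R * R * R).

(** The tangent space depends on the defining function only through the kernel
    of its differential: one inclusion is the chain rule, the other is
    [curve_with_velocity]. *)
Lemma tangent_space_kernel S h p v : C1 h -> 'd h p v != 0 ->
  (\forall q \near p, S q <-> h q = 0) -> S p ->
  tangent_space S p = [set w | 'd h p w = 0].
Proof.
move=> ch hv Sh Sp; have hp0 : h p = 0 by apply/(nbhs_singleton Sh).
apply/seteqP; split=> w /=.
  move=> [gamma [g0 Sg dg]].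
  apply: (@diff_velocity_eq0 _ _ h p gamma) => //.
    exact: (C1_differentiable ch p).
  have /differentiable_continuous cg : differentiable gamma 0.
    by apply/derivable1_diffP; case: dg.
  have := cg _ (eq_ind_r (fun x => nbhs x _) Sh g0) => /= Shg.
  near=> r; have [+ _] : S (gamma r) <-> h (gamma r) = 0 by near: r.
  by apply; near: r.
move=> hw.
have dh : \forall q \near p, differentiable h q.
  by apply: filterE => q; exact: (C1_differentiable ch q).
have [v' hv'] : exists v', 0 < 'd h p v'.
  have [hv0|hv0] := ltP 0 ('d h p v); first by exists v.
  by exists (- v); rewrite linearN oppr_gt0 lt_neqAle hv.
have [gamma [g0 hg dg]] := curve_with_velocity _ _ _ _ dh hp0 hv' hw.
exists gamma; split=> //.
have /differentiable_continuous cg : differentiable gamma 0.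
  by apply/derivable1_diffP; case: dg.
have := cg _ (eq_ind_r (fun x => nbhs x _) Sh g0) => /= Shg.
near=> r; have [_] : S (gamma r) <-> h (gamma r) = 0 by near: r.
by apply; near: r.
Unshelve. all: by end_near. Qed.

Lemma proportional_tangent_at S1 S2 h1 h2 p v (a b : R) :
  C1 h1 -> C1 h2 ->
  (\forall q \near p, S1 q <-> h1 q = 0) ->
  (\forall q \near p, S2 q <-> h2 q = 0) -> S1 p -> S2 p ->
  a != 0 -> b != 0 -> (forall w, a * 'd h2 p w = b * 'd h1 p w) ->
  'd h2 p v != 0 -> tangent_at S1 S2 p.
Proof.
move=> c1 c2 S1h S2h S1p S2p a0 b0 dh h2v.
have h1v : 'd h1 p v != 0.
  apply: contra_neq h2v => h1v; apply/eqP.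
  by rewrite -(mulrI_eq0 _ (mulfI a0)) dh h1v mulr0.
have s1 : is_surface_at S1 p.
  apply: (ex_intro _ h1 (And3 _ _ _)); [|by exists v|exact: S1h].
  apply: filterE => q; split=> [|u]; first exact: C1_differentiable c1 q.
  exact: C1_diff_continuous c1 u q.
have s2 : is_surface_at S2 p.
  apply: (ex_intro _ h2 (And3 _ _ _)); [|by exists v|exact: S2h].
  apply: filterE => q; split=> [|u]; first exact: C1_differentiable c2 q.
  exact: C1_diff_continuous c2 u q.
have k1 := tangent_space_kernel S1 h1 p v c1 h1v S1h S1p.
have k2 := tangent_space_kernel S2 h2 p v c2 h2v S2h S2p.
split=> //; rewrite k1 k2; apply/seteqP; split=> w /= hw; apply/eqP.
  by rewrite -(mulrI_eq0 _ (mulfI a0)) dh hw mulr0.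
by rewrite -(mulrI_eq0 _ (mulfI b0)) -dh hw mulr0.
Qed.
End Criterion.

(** * The coordinates of the wave manifold *)

Section Coordinates.
Context {R : realType}.
Implicit Type p : R * R * R.

Lemma C1_z : C1 (@z_of R).
Proof.
apply: (C1_linear ((@fst R R) \o (@fst (R * R)%type R))) => p.
by apply: (@continuous_comp _ _ _ fst fst); [exact: cvg_fst|exact: cvg_fst].
Qed.

Lemma C1_t : C1 (@t_of R).
Proof.
apply: (C1_linear ((@snd R R) \o (@fst (R * R)%type R))) => p.
by apply: (@continuous_comp _ _ _ fst snd); [exact: cvg_fst|exact: cvg_snd].
Qed.

Lemma C1_Y : C1 (@Y_of R).
Proof. by apply: (C1_linear (@snd (R * R)%type R)) => p; exact: cvg_snd. Qed.
End Coordinates.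

(** Structural recursion on the expression; the match is syntactic because
    trying the closure lemmas up to conversion is very slow. *)
Ltac C1_tac := lazymatch goal with
  | |- C1 (fun _ => ?c) => exact (C1_cst c)
  | |- C1 (fun x => z_of x) => exact C1_z
  | |- C1 (fun x => t_of x) => exact C1_t
  | |- C1 (fun x => Y_of x) => exact C1_Y
  | |- C1 (fun x => @?f x + @?g x) => refine (C1D f g _ _); C1_tac
  | |- C1 (fun x => @?f x * @?g x) => refine (C1M f g _ _); C1_tac
  | |- C1 (fun x => - @?f x) => refine (C1N f _); C1_tac
  | |- C1 (fun x => @?f x ^+ ?n) => refine (C1X f n _); C1_tac
  | H : C1 ?u |- C1 (fun x => ?u x) => exact H
  | H : C1 ?u |- C1 ?u => exact H
  end.

(** * The saturated of the coincidence curve *)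

Section Saturation.
Context {R : realType}.
Variables b1 a1 a2 a3 a4 : R.
Hypotheses (hb1 : 1 < b1) (hc : 0 < cc a2 a3).
Implicit Type p : R * R * R.

(** The coordinates A and B of the introduction: up to affine changes, the
    state (u, v) that a Hugoniot curve fixes. *)
Definition hugoniotU p : R := tildeU a2 a3 p + b1 / 2 * X_of p.
Definition hugoniotV p : R := V1 a2 a3 p + Y_of p / 2.

Definition SCC_poly p : R :=
  hugoniotU p ^+ 2 + 4 * hugoniotV p ^+ 2 - 4 * cc a2 a3 * hugoniotV p.

Definition sonic'_poly p : R :=
  - 2 * cc a2 a3 * ((b1 + 1) * z_of p ^+ 5 + (b1 + 4) * z_of p ^+ 3
                    + 3 * z_of p) * t_of p
  + ((b1 + 1) * z_of p ^+ 4 + b1 * z_of p ^+ 2 - 1) * Y_of p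
  - 2 * cc a2 a3 * ((b1 - 1) * z_of p ^+ 2 + 1).

Lemma sqr1_neq0 (x : R) : x ^+ 2 + 1 != 0.
Proof. by rewrite gt_eqF// ltr_wpDl// sqr_ge0. Qed.

(** The Hugoniot curve of a given point of the conic is that of (s, 0, 0) with
    s = A / (2B); the origin is the limit of s going to infinity and is not
    reached. *)
Lemma SCC_equation p :
  SCC b1 a1 a2 a3 a4 p <-> SCC_poly p = 0 /\ hugoniotV p != 0.
Proof.
have b10 : b1 != 0 by rewrite gt_eqF// (lt_trans ltr01).
have uE q : uR b1 a1 a2 a3 a4 q = (hugoniotU q - a1 + a4) / b1.
  by rewrite /uR /U_of /hugoniotU; field.
have vE q : vR a2 a3 q = hugoniotV q - a3.
  by rewrite /vR /V_of /hugoniotV; ring.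
have UE s : hugoniotU (s, 0, 0) = 2 * cc a2 a3 * s / (s ^+ 2 + 1).
  rewrite /hugoniotU /tildeU /X_of /z_of /t_of /Y_of /=.
  by field; exact: sqr1_neq0.
have VE s : hugoniotV (s, 0, 0) = cc a2 a3 / (s ^+ 2 + 1).
  rewrite /hugoniotV /V1 /z_of /t_of /Y_of /=.
  by field; exact: sqr1_neq0.
split.
  move=> [[[s t] Y] [/= t0 Y0]]; rewrite /t_of /Y_of /= in t0 Y0.
  rewrite t0 Y0 => -[]; rewrite !uE !vE UE VE => /(mulIf (invr_neq0 b10)) hU hV.
  have {}hU : hugoniotU p = 2 * cc a2 a3 * s / (s ^+ 2 + 1) by lra.
  have {}hV : hugoniotV p = cc a2 a3 / (s ^+ 2 + 1) by lra.
  rewrite /SCC_poly hU hV; split; first by field; exact: sqr1_neq0.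
  by rewrite mulf_neq0 ?invr_neq0 ?sqr1_neq0// gt_eqF.
move=> [Q0 V0]; rewrite /SCC_poly in Q0.
exists (hugoniotU p / (2 * hugoniotV p), 0, 0); first by [].
have s1 := sqr1_neq0 (hugoniotU p / (2 * hugoniotV p)).
have c0 : cc a2 a3 != 0 by rewrite gt_eqF.
have E : (hugoniotU p / (2 * hugoniotV p)) ^+ 2 + 1
    = cc a2 a3 / hugoniotV p.
  have : hugoniotU p ^+ 2 = 4 * cc a2 a3 * hugoniotV p - 4 * hugoniotV p ^+ 2.
    by lra.
  by rewrite expr_div_n => ->; field.
split; rewrite ?uE ?vE ?UE ?VE E.
  by field; rewrite b10 V0 c0.
by field; rewrite V0 c0.
Qed.

(** In terms of A, B, z and Y the equation of the wave manifold reads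
    2((z^2 - 1)B - zA + c) + DY = 0, and it is what turns Q into this form. *)
Lemma SCC_char_relation p :
  2 * hugoniotV p * ((b1 - 1) * z_of p ^+ 2 + 1) * Y_of p
    + 1 * (2 * z_of p * hugoniotV p - hugoniotU p) ^+ 2 = 1 * SCC_poly p.
Proof.
rewrite /SCC_poly /hugoniotU /hugoniotV /tildeU /V1 /X_of.
by field; exact: sqr1_neq0.
Qed.

(** Eliminating t through B gives G = 2(z^2+1)(EY - (E+2)B + 2c); then Y is
    eliminated as for the characteristic surface. *)
Lemma SCC_sonic'_relation p :
  hugoniotV p * ((b1 - 1) * z_of p ^+ 2 + 1) * sonic'_poly p
    + 2 * (z_of p ^+ 2 + 1) * (z_of p * hugoniotU p
        - ((b1 + 1) * z_of p ^+ 2 + 1) * hugoniotV p) ^+ 2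
  = 2 * (z_of p ^+ 2 + 1) * z_of p ^+ 2 * SCC_poly p.
Proof.
rewrite /SCC_poly /sonic'_poly /hugoniotU /hugoniotV /tildeU /V1 /X_of.
by field; exact: sqr1_neq0.
Qed.

Lemma C1_invsqr1 : C1 (fun p => (z_of p ^+ 2 + 1)^-1).
Proof.
apply: (C1V (fun p : R * R * R => z_of p ^+ 2 + 1)) => [|p].
  by C1_tac.
exact: sqr1_neq0.
Qed.

Lemma C1_hugoniotU : C1 hugoniotU.
Proof. by have h := C1_invsqr1; rewrite /hugoniotU /tildeU /X_of; C1_tac. Qed.

Lemma C1_hugoniotV : C1 hugoniotV.
Proof. by have h := C1_invsqr1; rewrite /hugoniotV /V1; C1_tac. Qed.

Lemma C1_SCC_poly : C1 SCC_poly.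
Proof.
(* The Hugoniot coordinates are generalized to keep them folded. *)
have polyC1 (u v : R * R * R -> R) : C1 u -> C1 v ->
    C1 (fun p => u p ^+ 2 + 4 * v p ^+ 2 - 4 * cc a2 a3 * v p).
  by move=> hu hv; C1_tac.
exact: polyC1 C1_hugoniotU C1_hugoniotV.
Qed.

Lemma C1_sonic'_poly : C1 sonic'_poly.
Proof. by rewrite /sonic'_poly; C1_tac. Qed.

Lemma near_SCC p : SCC b1 a1 a2 a3 a4 p ->
  \forall q \near p, SCC b1 a1 a2 a3 a4 q <-> SCC_poly q = 0.
Proof.
move=> /SCC_equation[_ Vp].
have cV := C1_continuous _ C1_hugoniotV p.
apply: filterS (cvgr_neq0 _ cV Vp) => q Vq.
by split=> [/SCC_equation[]|Qq] //; apply/SCC_equation.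
Qed.

Lemma quadratic_gt0 (x : R) : 0 < (b1 - 1) * x ^+ 2 + 1.
Proof. by rewrite ltr_wpDl// mulr_ge0 ?sqr_ge0// subr_ge0 ltW. Qed.

Lemma SCC_tangent_characteristic :
  tangent_surfaces (SCC b1 a1 a2 a3 a4) (characteristic_surface R).
Proof.
split; first by exists 0; split=> //; exists 0.
move=> p [Sp Cp]; have [Q0 V0] := (SCC_equation p).1 Sp.
pose f q := 2 * hugoniotV q * ((b1 - 1) * z_of q ^+ 2 + 1).
pose e q := 2 * z_of q * hugoniotV q - hugoniotU q.
have hV := C1_hugoniotV; have hU := C1_hugoniotU.
have hf : C1 f by rewrite /f; C1_tac.
have he : C1 e by rewrite /e; C1_tac.
have f0 : f p != 0.
  by rewrite /f mulf_neq0 ?mulf_neq0// gt_eqF// quadratic_gt0.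
have dYQ w : f p * 'd (@Y_of R) p w = 1 * 'd SCC_poly p w.
  exact: (diff_relation f (@Y_of R) (fun=> 1) e (fun=> 1) SCC_poly p w
    hf C1_Y (C1_cst 1) he (C1_cst 1) C1_SCC_poly SCC_char_relation
    (oner_neq0 _) Cp Q0).
have dY : 'd (@Y_of R) p (0, 0, 1) = 1.
  apply: diff_along_line; first exact: C1_differentiable C1_Y p.
  by move=> r.
have dY0 : 'd (@Y_of R) p (0, 0, 1) != 0 by rewrite dY oner_neq0.
have nearC : \forall q \near p, characteristic_surface R q <-> Y_of q = 0.
  by apply: filterE => q.
exact: (proportional_tangent_at _ _ _ _ p _ _ _ C1_SCC_poly C1_Y
  (near_SCC p Sp) nearC Sp Cp f0 (oner_neq0 _) dYQ dY0).
Qed.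

(** On SCC the sonic' points are those with 2zs = (b1+1)z^2 + 1; this is the one
    with z = 1, s = (b1+2)/2. *)
Lemma SCC_sonic'_point :
  let N := b1 ^+ 2 + 4 * b1 + 8 in
  (SCC b1 a1 a2 a3 a4 `&` sonic' b1 a2 a3)
    (1, - (b1 * (b1 + 2)) / (2 * N), - (2 * cc a2 a3 * b1) / N).
Proof.
move=> N; have b10 : 0 < b1 by rewrite (lt_trans ltr01).
have c0 : cc a2 a3 != 0 by rewrite gt_eqF.
have N0 : b1 ^+ 2 + 4 * b1 + 8 != 0 by rewrite gt_eqF//; nra.
split.
  apply/SCC_equation.
  rewrite /SCC_poly; set p := (1, _, _).
  have -> : hugoniotV p = 4 * cc a2 a3 / N.
    rewrite /hugoniotV /V1 /z_of /t_of /Y_of /= /N; field; exact: N0.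
  have -> : hugoniotU p = 4 * cc a2 a3 * (b1 + 2) / N.
    rewrite /hugoniotU /tildeU /X_of /z_of /t_of /Y_of /= /N; field.
    exact: N0.
  split; first by rewrite /N; field; exact: N0.
  by rewrite mulf_neq0 ?invr_neq0// mulf_neq0// pnatr_eq0.
rewrite /sonic' /z_of /t_of /Y_of /= /N; field; exact: N0.
Qed.

Lemma SCC_sonic'_z_neq0 p :
  SCC b1 a1 a2 a3 a4 p -> sonic' b1 a2 a3 p -> z_of p != 0.
Proof.
move=> /SCC_equation[Q0 V0] Gp; apply/eqP => z0.
have G0 : sonic'_poly p = 0 by exact: Gp.
have := SCC_sonic'_relation p; rewrite Q0 G0 z0 => V20.
have /eqP : hugoniotV p ^+ 2 = 0 by lra.
by rewrite expf_eq0 (negbTE V0).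
Qed.

Lemma SCC_tangent_sonic' :
  tangent_surfaces (SCC b1 a1 a2 a3 a4) (sonic' b1 a2 a3).
Proof.
split; first by exists (1, - (b1 * (b1 + 2)) / (2 * (b1 ^+ 2 + 4 * b1 + 8)),
  - (2 * cc a2 a3 * b1) / (b1 ^+ 2 + 4 * b1 + 8)); exact: SCC_sonic'_point.
move=> p [Sp Gp]; have z0 := SCC_sonic'_z_neq0 p Sp Gp.
have [Q0 V0] := (SCC_equation p).1 Sp.
pose f q := hugoniotV q * ((b1 - 1) * z_of q ^+ 2 + 1).
pose k (q : R * R * R) := 2 * (z_of q ^+ 2 + 1).
pose e q := z_of q * hugoniotU q
  - ((b1 + 1) * z_of q ^+ 2 + 1) * hugoniotV q.
pose m (q : R * R * R) := 2 * (z_of q ^+ 2 + 1) * z_of q ^+ 2.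
have hV := C1_hugoniotV; have hU := C1_hugoniotU.
have hf : C1 f by rewrite /f; C1_tac.
have he : C1 e by rewrite /e; C1_tac.
have hk : C1 k by rewrite /k; C1_tac.
have hm : C1 m by rewrite /m; C1_tac.
have k0 : k p != 0 by rewrite mulf_neq0 ?sqr1_neq0// pnatr_eq0.
have f0 : f p != 0 by rewrite /f mulf_neq0// gt_eqF// quadratic_gt0.
have m0 : m p != 0 by rewrite /m mulf_neq0 ?expf_neq0//; exact: k0.
have dGQ w : f p * 'd sonic'_poly p w = m p * 'd SCC_poly p w.
  exact: (diff_relation f sonic'_poly k e m SCC_poly p w
    hf C1_sonic'_poly hk he hm C1_SCC_poly SCC_sonic'_relation k0 Gp Q0).
(* Along the t axis sonic'_poly is affine, with the slope factored below. *)
have dG : 'd sonic'_poly p (0, 1, 0) = - 2 * cc a2 a3 * z_of p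
    * (z_of p ^+ 2 + 1) * ((b1 + 1) * z_of p ^+ 2 + 3).
  apply: diff_along_line; first exact: C1_differentiable C1_sonic'_poly p.
  move=> r; case: (p) => [[z t] Y].
  have -> : (z, t, Y) + r *: ((0, 1, 0) : R * R * R) = (z, t + r, Y).
    by congr (_, _, _); rewrite /= ?scaler0 ?addr0// [r *: 1]mulr1.
  by rewrite /sonic'_poly /z_of /t_of /Y_of /=; ring.
have dG0 : 'd sonic'_poly p (0, 1, 0) != 0.
  have c0 : cc a2 a3 != 0 by rewrite gt_eqF.
  have n2 : - 2 != 0 :> R by rewrite oppr_eq0 pnatr_eq0.
  have w0 : (b1 + 1) * z_of p ^+ 2 + 3 != 0.
    have b10 : 0 <= b1 + 1 by rewrite addr_ge0 ?ltW ?(lt_trans ltr01 hb1).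
    by rewrite gt_eqF// ltr_wpDl// mulr_ge0// sqr_ge0.
  by rewrite dG; do ![apply: mulf_neq0] => //; exact: sqr1_neq0.
have nearG : \forall q \near p, sonic' b1 a2 a3 q <-> sonic'_poly q = 0.
  by apply: filterE => q.
exact: (proportional_tangent_at _ _ _ _ p _ _ _ C1_SCC_poly C1_sonic'_poly
  (near_SCC p Sp) nearG Sp Gp f0 m0 dGQ dG0).
Qed.

End Saturation.

(** * Tangency *)

Theorem lemma2 (R : realType) (b1 a1 a2 a3 a4 : R)
    (hb1 : 1 < b1) (hc : 0 < a3 - a2) :
  tangent_surfaces (SCC b1 a1 a2 a3 a4) (characteristic_surface R) /\
  tangent_surfaces (SCC b1 a1 a2 a3 a4) (sonic' b1 a2 a3).
Proof.
split; first exact: SCC_tangent_characteristic.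
exact: SCC_tangent_sonic'.
Qed.
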